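(* Let $D\in\mathbb{C}^{n\times n}$ be a Hermitian matrix of the form $D=\begin{bmatrix}D_1&0\\ 0&D_2\end{bmatrix}$ with $D_1=\lambda_1 I$, and let $gap=\min_{\lambda\in\Lambda(D_2)}|\lambda_1-\lambda|>0$. Let $E$ be a Hermitian perturbation of the form $$E=\begin{bmatrix}0&E_1\\ E_1^*&0\end{bmatrix},\qquad\text{and let}\qquad B=\begin{bmatrix}0&B_1\\ -B_1^*&0\end{bmatrix},$$ both partitioned conformally with $D$, where $B_1$ satisfies $E_1=D_1B_1-B_1D_2$. Let $\lambda_i(1)$ be the $i$-th eigenvalue of $D+E$ and let $\lambda_i$ be the $i$-th eigenvalue of $D$, and assume that $\lambda_i$ is an eigenvalue of $D_1$. Then $$|\lambda_i(1)-\lambda_i|\le\frac12\|B_1E_1^*+E_1B_1^*\|+\frac23\,\frac{\|E_1\|^2\|B_1\|}{gap-\|E_1\|}.$$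
   Context: $\|\cdot\|$ is the spectral norm; $\Lambda(\cdot)$ denotes the spectrum; $^*$ denotes the conjugate transpose. For $t\in[0,1]$, $\lambda_i(t)$ denotes the eigenvalue of $D+tE$ that is the perturbation of the $i$-th eigenvalue $\lambda_i=\lambda_i(0)$ of $D$, and $\lambda_i(1)$ is its value at $t=1$. The symbol $\lambda_1$ denotes the scalar with $D_1=\lambda_1I$.
   Formalization: The formal theorem adds the assumption ‖E_1‖ < gap: at ‖E_1‖ = gap the bound is undefined, and for ‖E_1‖ slightly above gap it is negative and the claim fails (D = diag(0,1), E_1 slightly larger than 1). *)

(* Defs.v *)
From HB Require Import structures.
From mathcomp Require Import all_boot all_order all_algebra.
From mathcomp Require Import all_classical all_reals all_analysis.
From mathcomp Require Export complex.
Set Implicit Arguments.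
Unset Strict Implicit.
Unset Printing Implicit Defensive.
Import Order.TTheory GRing.Theory Num.Theory.
Import numFieldNormedType.Exports.
Local Open Scope classical_set_scope.
Local Open Scope sesquilinear_scope.
Local Open Scope ring_scope.
Local Open Scope complex_scope.

(* Absolute value of a complex number, as an element of R: the norm `|z| of the
   numClosedFieldType R[i] takes its values in R[i]. *)
Definition cabs (R : realType) (z : R[i]) : R := ComplexField.Normc.normc z.

Definition euclidean_norm (R : realType) (n : nat) (x : 'cV[R[i]]_n) : R :=
  Num.sqrt (\sum_i cabs (x i 0) ^+ 2).

(* The unit ball rather than the unit sphere, so that the supremum is taken over
   a nonempty set (and is 0) when n = 0. *)
Definition spectral_norm (R : realType) (m n : nat) (A : 'M[R[i]]_(m, n)) : R :=
  sup [set euclidean_norm (A *m x) | x in [set x | euclidean_norm x <= 1]].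

Definition is_min (R : realType) (S : set R) (a : R) : Prop :=
  S a /\ lbound S a.

(* lam i t is the i-th eigenvalue of the Hermitian matrix A t, for t in [0, 1],
   all eigenvalues being listed with multiplicity. Since A 0 may have multiple
   eigenvalues, "the i-th eigenvalue and its perturbation" can be read in two
   ways, both allowed here: each lam i is continuous (it follows lam i 0 along
   t), or the eigenvalues of each A t are numbered in nondecreasing order. *)
Definition eigenvalue_family (R : realType) (n : nat) (A : R -> 'M[R[i]]_n)
    (lam : 'I_n -> R -> R) : Prop :=
  (forall t : R, 0 <= t <= 1 ->
     char_poly (A t) = \prod_i ('X - ((lam i t)%:C)%:P)) /\
  ((forall i : 'I_n, {within `[0%R, 1%R], continuous (lam i)}) \/
   (forall t : R, 0 <= t <= 1 ->
      forall i j : 'I_n, (i <= j)%N -> lam i t <= lam j t)).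

(* Main.v *)
(** Let l be the scalar of the first block, P* diag(d) P the second block, and
    l + m an eigenvalue of D + t E with |m| < gap. Eliminating the second
    component of an eigenvector (x, y) leaves the secular equation
      m |x|^2 = t^2 sum_j p_j / (m + delta_j),
    with p_j = |(x E1 P* )_j|^2, delta_j = l - d_j and |delta_j| >= gap. Comparing
    signs gives |m| gap <= ||E1||^2, so no eigenvalue crosses the annulus
    ||E1||^2 / gap < |m| < gap. Continuity of the branch, or Weyl's inequality
    when the eigenvalues are sorted, hence keeps |m| < gap up to t = 1.
    Since B1 E1* = E1 (l - D2)^-1 E1* is Hermitian, sum_j p_j / delta_j is half the
    quadratic form of B1 E1* + E1 B1*, and
    1 / (m + delta) = 1 / delta - m / (delta (m + delta)) bounds the remainder by
    |m| ||E1|| ||B1|| / (gap - |m|) <= ||E1||^2 ||B1|| / (2 (gap - ||E1||)),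
    which is even better than the constant 2/3. *)
Require Import Defs.
From HB Require Import structures.
From mathcomp Require Import all_boot all_order all_algebra.
From mathcomp Require Import all_classical all_reals all_analysis.
From mathcomp Require Import zify ring lra.
Import Order.TTheory GRing.Theory Num.Theory.
Import numFieldNormedType.Exports.
Local Open Scope classical_set_scope.
Local Open Scope sesquilinear_scope.
Local Open Scope ring_scope.
Local Open Scope complex_scope.
Set Implicit Arguments.
Unset Strict Implicit.
Unset Printing Implicit Defensive.


(** Rows, because the eigenvectors behind [eigenvalue] are row vectors; squared, so that most
    estimates avoid square roots. *)
Definition sqnorm (R : realType) (n : nat) (u : 'rV[R[i]]_n) : R :=
  \sum_j cabs (u 0 j) ^+ 2.

(** * Euclidean and spectral norms *)

Section Norms.
Context {R : realType}.
Implicit Types m n p : nat.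

Lemma cabsE (z : R[i]) : `|z| = (cabs z)%:C.
Proof. by []. Qed.

Lemma cabs_ge0 (z : R[i]) : 0 <= cabs z.
Proof. by rewrite -ler0c -cabsE normr_ge0. Qed.

Lemma cabs_real (x : R) : cabs x%:C = `|x|.
Proof. by rewrite /cabs /= expr0n /= addr0 sqrtr_sqr. Qed.

Lemma cabs_sqrE (z : R[i]) : (cabs z ^+ 2)%:C = z * Num.conj z.
Proof. by rewrite rmorphXn /= -cabsE normCK. Qed.

Lemma cabs_conj (z : R[i]) : cabs (Num.conj z) = cabs z.
Proof. by apply: complexI; rewrite -!cabsE norm_conjC. Qed.

Lemma sqnormE n (u : 'rV[R[i]]_n) : (sqnorm u)%:C = (u *m u^t*) 0 0.
Proof.
rewrite /sqnorm rmorph_sum mxE; apply: eq_bigr => j _.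
by rewrite [LHS]cabs_sqrE !mxE.
Qed.

Lemma sqnorm_ge0 n (u : 'rV[R[i]]_n) : 0 <= sqnorm u.
Proof. by apply: sumr_ge0 => j _; rewrite sqr_ge0. Qed.

Lemma sqnorm_gt0 n (u : 'rV[R[i]]_n) : (0 < sqnorm u) = (u != 0).
Proof.
rewrite lt_neqAle sqnorm_ge0 andbT eq_sym; congr (~~ _).
rewrite psumr_eq0; last by move=> j _; rewrite sqr_ge0.
apply/allP/eqP => [u0|-> j _]; last first.
  by rewrite mxE [cabs _]ComplexField.Normc.normc0 expr0n /= eqxx.
apply/rowP => j; rewrite mxE; apply/eqP; rewrite -normr_eq0 cabsE.
have := u0 j (mem_index_enum j); rewrite sqrf_eq0 => /eqP ->.
exact: eqxx.
Qed.

Lemma sqnorm0 n : sqnorm (0 : 'rV[R[i]]_n) = 0.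
Proof. by apply/eqP; rewrite eq_le sqnorm_ge0 leNgt sqnorm_gt0 eqxx. Qed.

Lemma sqnormZ n (a : R) (u : 'rV[R[i]]_n) :
  sqnorm (a%:C *: u) = a ^+ 2 * sqnorm u.
Proof.
rewrite /sqnorm mulr_sumr; apply: eq_bigr => j _.
by rewrite mxE [cabs _]ComplexField.Normc.normcM exprMn [_ a%:C]cabs_real real_normK // num_real.
Qed.

Lemma sqnorm_unitary n (u : 'rV[R[i]]_n) (P : 'M[R[i]]_n) :
  P \is unitarymx -> sqnorm (u *m P^t*) = sqnorm u.
Proof.
move=> uP; apply: complexI; rewrite !sqnormE trmx_mul map_mxM trmxCK.
by rewrite mulmxA mulmxKtV.
Qed.

Lemma cauchy_schwarz n (u v : 'rV[R[i]]_n) :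
  cabs ((u *m v^t*) 0 0) ^+ 2 <= sqnorm u * sqnorm v.
Proof.
have := (CauchySchwarz (@dotmx R[i] n) u v).1.
by rewrite /= !dotmxE -!sqnormE cabsE -rmorphXn -rmorphM lecR.
Qed.

Lemma euclidean_normE n (x : 'cV[R[i]]_n) :
  euclidean_norm x = Num.sqrt (sqnorm (x^t*)).
Proof.
by congr Num.sqrt; apply: eq_bigr => j _; rewrite !mxE cabs_conj.
Qed.

Lemma sqr_euclidean_norm n (x : 'cV[R[i]]_n) :
  euclidean_norm x ^+ 2 = sqnorm (x^t*).
Proof. by rewrite euclidean_normE sqr_sqrtr // sqnorm_ge0. Qed.

Lemma euclidean_norm_ge0 n (x : 'cV[R[i]]_n) : 0 <= euclidean_norm x.
Proof. exact: sqrtr_ge0. Qed.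

(** The Frobenius norm is a bound, by Cauchy-Schwarz on each row. Boundedness is what makes the
    supremum dominate the elements of its set. *)
Lemma spectral_norm_has_ubound m n (A : 'M[R[i]]_(m, n)) :
  has_ubound [set euclidean_norm (A *m x) | x in [set x | euclidean_norm x <= 1]].
Proof.
exists (Num.sqrt (\sum_j sqnorm (row j A))) => _ [x /= x1 <-].
rewrite euclidean_normE ler_wsqrtr // /sqnorm -/(sqnorm _).
apply: ler_sum => j _; rewrite -/(sqnorm _).
have -> : (A *m x)^t* 0 j = Num.conj ((row j A *m x) 0 0).
  by rewrite !mxE; congr (Num.conj _); apply: eq_bigr => k _; rewrite !mxE.
rewrite cabs_conj -[x]trmxCK; apply: le_trans (cauchy_schwarz _ _) _.
rewrite -[leRHS]mulr1 ler_wpM2l ?sqnorm_ge0 // -sqr_euclidean_norm.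
by rewrite expr_le1 // euclidean_norm_ge0.
Qed.

Lemma spectral_norm_ge0 m n (A : 'M[R[i]]_(m, n)) : 0 <= spectral_norm A.
Proof.
apply: (ub_le_sup (spectral_norm_has_ubound A)); exists 0 => /=.
  by rewrite euclidean_normE trmx0 map_mx0 sqnorm0 sqrtr0 ler01.
by rewrite mulmx0 euclidean_normE trmx0 map_mx0 sqnorm0 sqrtr0.
Qed.

(** The column [u^t*], scaled to length one, competes in the supremum that defines the norm. *)
Lemma sqnorm_mulmx_adj m n (A : 'M[R[i]]_(m, n)) (u : 'rV[R[i]]_n) :
  sqnorm (u *m A^t*) <= spectral_norm A ^+ 2 * sqnorm u.
Proof.
have [->|u0] := eqVneq u 0; first by rewrite mul0mx !sqnorm0 mulr0.
have s0 : 0 < sqnorm u by rewrite sqnorm_gt0.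
set s := Num.sqrt (sqnorm u); have sE : s ^+ 2 = sqnorm u by rewrite sqr_sqrtr // ltW.
have sp : 0 < s by rewrite sqrtr_gt0.
have : euclidean_norm (A *m (s^-1%:C *: u)^t*) <= spectral_norm A.
  apply: (ub_le_sup (spectral_norm_has_ubound A)); exists ((s^-1%:C *: u)^t*) => //=.
  rewrite euclidean_normE trmxCK sqnormZ exprVn -sE mulVf ?sqrtr1 //.
  by rewrite expf_neq0 // gt_eqF.
rewrite -(@ler_pXn2r _ 2) ?nnegrE ?spectral_norm_ge0 ?euclidean_norm_ge0 //.
rewrite sqr_euclidean_norm trmx_mul map_mxM trmxCK -scalemxAl sqnormZ.
by rewrite exprVn sE mulrC ler_pdivrMr.
Qed.

(* The adjoint has the same norm: |uA|^2 = <uAA*, u> <= |(uA)A*| |u|. *)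
Lemma sqnorm_mulmx m n (A : 'M[R[i]]_(m, n)) (u : 'rV[R[i]]_m) :
  sqnorm (u *m A) <= spectral_norm A ^+ 2 * sqnorm u.
Proof.
have [/eqP-> | s0] := boolP (sqnorm (u *m A) == 0).
  by rewrite mulr_ge0 ?sqr_ge0 ?sqnorm_ge0.
have {}s0 : 0 < sqnorm (u *m A) by rewrite lt_neqAle eq_sym s0 sqnorm_ge0.
rewrite -(ler_pM2l s0).
have h : sqnorm (u *m A) = cabs ((u *m A *m A^t* *m u^t*) 0 0).
  rewrite -mulmxA -map_mxM -trmx_mul -sqnormE cabs_real ger0_norm //.
  exact: sqnorm_ge0.
rewrite -expr2 {1}h; apply: le_trans (cauchy_schwarz _ _) _.
rewrite mulrCA mulrA ler_wpM2r ?sqnorm_ge0 //.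
by rewrite [leRHS]mulrC mulrC sqnorm_mulmx_adj.
Qed.

Lemma spectral_norm_form n (A : 'M[R[i]]_n) (u : 'rV[R[i]]_n) :
  cabs ((u *m A *m u^t*) 0 0) <= spectral_norm A * sqnorm u.
Proof.
rewrite -(@ler_pXn2r _ 2) ?nnegrE ?cabs_ge0 ?mulr_ge0 ?spectral_norm_ge0 ?sqnorm_ge0 //.
apply: le_trans (cauchy_schwarz _ _) _.
by rewrite exprMn [_ ^+ 2 in leRHS]expr2 mulrA ler_wpM2r ?sqnorm_ge0 ?sqnorm_mulmx.
Qed.

End Norms.

(** * Spectral theorem and Weyl's inequality *)

Section HermitianSpectrum.
Context {R : realType}.
Local Notation C := R[i].

Lemma hermitian_diagonalization n (A : 'M[C]_n) : A \is hermsymmx ->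
  exists (P : 'M[C]_n) (d : 'I_n -> R), P \is unitarymx /\
    A = P^t* *m diag_mx (\row_j (d j)%:C) *m P.
Proof.
move=> hA; have /orthomx_spectralP := hermitian_normalmx hA.
rewrite invmx_unitary ?spectral_unitarymx // => eA.
(* Hermitian matrices have real eigenvalues, so taking real parts loses nothing. *)
exists (spectralmx A), (fun j => complex.Re (spectral_diag A 0 j)).
split; first exact: spectral_unitarymx.
suff -> : \row_j (complex.Re (spectral_diag A 0 j))%:C = spectral_diag A by [].
apply/rowP => j; rewrite mxE.
by rewrite RRe_real //; exact: (mxOverP (hermitian_spectral_diag_real hA)).
Qed.

Lemma diag_quadratic_form n (P : 'M[C]_n) (d : 'I_n -> R) (u : 'rV[C]_n) :
  (u *m (P^t* *m diag_mx (\row_j (d j)%:C) *m P) *m u^t*) 0 0 =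
  (\sum_j d j * cabs ((u *m P^t*) 0 j) ^+ 2)%:C.
Proof.
rewrite !mulmxA -[_ *m P *m _]mulmxA.
have -> : P *m u^t* = (u *m P^t*)^t* by rewrite trmx_mul map_mxM trmxCK.
move: (u *m P^t*) => v; rewrite mul_mx_diag rmorph_sum mxE.
apply: eq_bigr => j _.
by rewrite rmorphM /= [X in _ = _ * X]cabs_sqrE !mxE mulrCA mulrA.
Qed.

Lemma char_poly_unitary_diag n (P : 'M[C]_n) (d : 'rV[C]_n) :
  P \is unitarymx ->
  char_poly (P^t* *m diag_mx d *m P) = \prod_j ('X - (d 0 j)%:P).
Proof.
move=> uP; have PP : P^t* *m P = 1%:M.
  by rewrite -invmx_unitary // mulVmx // unitarymx_unit.
have cP : map_mx polyC (P^t*) *m map_mx polyC P = 1%:M.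
  by rewrite -map_mxM PP map_mx1.
rewrite /char_poly.
have -> : char_poly_mx (P^t* *m diag_mx d *m P) =
    map_mx polyC (P^t*) *m char_poly_mx (diag_mx d) *m map_mx polyC P.
  rewrite /char_poly_mx mulmxBr mulmxBl !map_mxM; congr (_ - _).
  by rewrite mul_mx_scalar -scalemxAl cP scalemx1.
rewrite !det_mulmx mulrAC -det_mulmx cP det1 mul1r -/(char_poly _).
rewrite char_poly_trig ?diag_mx_is_trig //.
by apply: eq_bigr => j _; rewrite !mxE eqxx mulr1n.
Qed.

(** Unique factorization makes the two families of roots permutations of each other. *)
Lemma card_spectrum n (P : 'M[C]_n) (d a : 'I_n -> R) (p : pred R) :
  P \is unitarymx ->
  char_poly (P^t* *m diag_mx (\row_j (d j)%:C) *m P) =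
    \prod_j ('X - ((a j)%:C)%:P) ->
  #|[pred j | p (d j)]| = #|[pred j | p (a j)]|.
Proof.
move=> uP; rewrite char_poly_unitary_diag // => e.
have /prod_XsubC_eq/permP/(_ (fun z => p (complex.Re z))) :
    \prod_(x <- [seq (d j)%:C | j <- enum 'I_n]) ('X - x%:P) =
    \prod_(x <- [seq (a j)%:C | j <- enum 'I_n]) ('X - x%:P).
  rewrite !big_image /= -e.
  by apply: eq_bigr => j _; rewrite mxE.
by rewrite !count_map !cardE !size_filter.
Qed.

(** The selected columns of [M] and [M'] form [K], which has fewer than [n] columns and hence a
    nonzero left kernel. *)
Lemma exists_row_vanishing n (M M' : 'M[C]_n) (S S' : pred 'I_n) :
  (#|S| + #|S'| < n)%N ->
  exists u : 'rV[C]_n, [/\ u != 0, forall j, j \in S -> (u *m M) 0 j = 0 &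
    forall j, j \in S' -> (u *m M') 0 j = 0].
Proof.
move=> ltn.
pose K := row_mx (colsub (@enum_val _ S) M) (colsub (@enum_val _ S') M').
have : kermx K != 0.
  rewrite -mxrank_eq0 mxrank_ker -lt0n subn_gt0.
  exact: leq_ltn_trans (rank_leq_col K) ltn.
case/rowV0Pn => u /sub_kermxP uK u0; exists u.
move: uK; rewrite mul_mx_row -[RHS]row_mx0 => /eq_row_mx[h h'].
split=> // j jS.
  have /rowP/(_ (enum_rank_in jS j)) := h; rewrite !mxE => e; rewrite -[RHS]e.
  by apply: eq_bigr => k _; rewrite mxE enum_rankK_in.
have /rowP/(_ (enum_rank_in jS j)) := h'; rewrite !mxE => e; rewrite -[RHS]e.
by apply: eq_bigr => k _; rewrite mxE enum_rankK_in.
Qed.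

(* Dimension count: the span of the eigenvectors of [A] for eigenvalues at most
   [a i] and that of the eigenvectors of [A'] for eigenvalues at least [a' i]
   share a nonzero vector. *)
Lemma weyl_le n (A A' : 'M[C]_n) (a a' : 'I_n -> R) (e : R) (i : 'I_n) :
  A \is hermsymmx -> A' \is hermsymmx ->
  char_poly A = \prod_j ('X - ((a j)%:C)%:P) ->
  char_poly A' = \prod_j ('X - ((a' j)%:C)%:P) ->
  (forall j k : 'I_n, (j <= k)%N -> a j <= a k) ->
  (forall j k : 'I_n, (j <= k)%N -> a' j <= a' k) ->
  (forall u : 'rV[C]_n,
     (u *m A' *m u^t*) 0 0 <= (u *m A *m u^t*) 0 0 + (e * sqnorm u)%:C) ->
  a' i <= a i + e.
Proof.
move=> /hermitian_diagonalization[P [d [uP ->]]].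
move=> /hermitian_diagonalization[P' [d' [uP' ->]]] ca ca' sa sa' le_form.
have := @exists_row_vanishing n (P^t*) (P'^t*)
  [pred j | a i < d j] [pred j | d' j < a' i].
rewrite (card_spectrum (fun x => a i < x) uP ca).
rewrite (card_spectrum (fun x => x < a' i) uP' ca').
case=> [|u [u0 hu hu']].
  (* At least [i + 1] of the [a j] do not exceed [a i], and at most [i] of the [a' j] lie below
     [a' i]; so at most [n - 1] conditions fall on [u]. *)
  have : (#|[pred j : 'I_n | (j <= i)%N]| + #|[pred j | (a i < a j)%R]| <= n)%N.
    rewrite -cardUI addnC (eq_card0 (A := [predI _ & _])).
      by rewrite add0n; apply: leq_trans (max_card _) _; rewrite card_ord.
    move=> j; rewrite !inE; case: (leqP j i) => //= ji.
    by apply/negbTE; rewrite -leNgt sa.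
  have : (#|[pred j | (a' j < a' i)%R]| < #|[pred j : 'I_n | (j <= i)%N]|)%N.
    apply: proper_card; apply/properP; split.
      apply/fintype.subsetP => j; rewrite !inE; apply: contraLR.
      by rewrite -ltnNge -leNgt => /ltnW /sa'.
    by exists i; rewrite !inE // ltxx.
  by lia.
have s0 : 0 < sqnorm u by rewrite sqnorm_gt0.
have := le_form u; rewrite !diag_quadratic_form -rmorphD lecR => le_sum.
(* Both forms are compared termwise with multiples of [sqnorm u]; where the eigenvalue comparison
   fails, the coordinate of [u] is zero. *)
rewrite -(ler_pM2r s0) mulrDl; apply: le_trans (le_trans le_sum _).
  rewrite -(sqnorm_unitary u uP') mulr_sumr; apply: ler_sum => j _.
  have [lt|le] := ltP (d' j) (a' i); last by rewrite ler_wpM2r ?sqr_ge0.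
  by rewrite hu' // [cabs _]ComplexField.Normc.normc0 expr0n /= !mulr0.
rewrite lerD2r -(sqnorm_unitary u uP) mulr_sumr; apply: ler_sum => j _.
have [lt|le] := ltP (a i) (d j); last by rewrite ler_wpM2r ?sqr_ge0.
by rewrite hu // [cabs _]ComplexField.Normc.normc0 expr0n /= !mulr0.
Qed.

End HermitianSpectrum.

(** * Real estimates for roots of the secular equation *)

Section SecularBounds.
Context {R : realType} {n : nat}.
Implicit Types (p d : 'I_n -> R) (g m e b t N X : R).

(** The sum of [p j * (A * d j - S) ^+ 2] is nonnegative and equals [A * (A * B - S ^+ 2)], which
    settles [A > 0]; if [A = 0], every weight is zero. *)
Lemma weighted_cauchy_schwarz p d : (forall j, 0 <= p j) ->
  (\sum_j p j * d j) ^+ 2 <= (\sum_j p j) * (\sum_j p j * d j ^+ 2).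
Proof.
move=> p0; set A := \sum_j p j; set S := \sum_j p j * d j.
set B := \sum_j p j * d j ^+ 2.
have A0 : 0 <= A by apply: sumr_ge0.
have [A_eq0|A_neq0] := eqVneq A 0.
  have S0 : S = 0.
    apply: big1 => j _; move/eqP: A_eq0; rewrite psumr_eq0 // => /allP.
    by move=> /(_ j (mem_index_enum j)) /eqP ->; rewrite mul0r.
  by rewrite S0 A_eq0 mul0r expr0n.
have expand a s : \sum_j p j * (a * d j - s) ^+ 2 =
    a ^+ 2 * B - 2 * a * s * S + s ^+ 2 * A.
  rewrite /A /B /S !mulr_sumr -sumrB -big_split; apply: eq_bigr => j _ /=.
  by ring.
have : 0 <= \sum_j p j * (A * d j - S) ^+ 2.
  by apply: sumr_ge0 => j _; rewrite mulr_ge0 ?sqr_ge0.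
have -> : \sum_j p j * (A * d j - S) ^+ 2 = A * (A * B - S ^+ 2).
  by rewrite expand; ring.
by rewrite pmulr_rge0 ?subr_ge0 // lt_neqAle eq_sym A_neq0.
Qed.

(** If [d j >= g], the term is at most [p j / g] since [m >= 0]; if [d j <= - g], it is at most 0
    since [m < g]. *)
Lemma secular_root_bound_pos p d g m e t X :
  0 < g -> (forall j, 0 <= p j) -> (forall j, g <= `|d j|) -> 0 <= m < g ->
  0 <= t <= 1 -> 0 < X -> \sum_j p j <= e ^+ 2 * X ->
  m * X = t ^+ 2 * \sum_j p j / (m + d j) -> m * g <= e ^+ 2.
Proof.
move=> g0 p0 gd /andP[m0 mg] /andP[t0 t1] X0 pX mX.
have le_sum : \sum_j p j / (m + d j) <= (\sum_j p j) / g.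
  rewrite mulr_suml; apply: ler_sum => j _; rewrite ler_wpM2l //.
  have := gd j; have [d0|d0] := ger0P (d j) => gdj.
    by rewrite lef_pV2 ?posrE; lra.
  by apply: (@le_trans _ _ 0); rewrite ?invr_le0 ?invr_ge0; lra.
have pg : (\sum_j p j) / g <= e ^+ 2 * X / g by rewrite ler_wpM2r // invr_ge0 ltW.
have pg0 : 0 <= (\sum_j p j) / g by rewrite divr_ge0 ?sumr_ge0 // ltW.
have : m * X <= e ^+ 2 * X / g.
  rewrite mX; apply: le_trans pg.
  apply: (@le_trans _ _ (t ^+ 2 * ((\sum_j p j) / g))).
    by rewrite ler_wpM2l ?sqr_ge0.
  by rewrite ler_piMl // exprn_ile1.
by rewrite ler_pdivlMr // mulrAC ler_pM2r.
Qed.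

(** Negating both [m] and [d] preserves the equation and reduces a negative root to a positive
    one. *)
Lemma secular_root_bound p d g m e t X :
  0 < g -> (forall j, 0 <= p j) -> (forall j, g <= `|d j|) -> `|m| < g ->
  0 <= t <= 1 -> 0 < X -> \sum_j p j <= e ^+ 2 * X ->
  m * X = t ^+ 2 * \sum_j p j / (m + d j) -> `|m| * g <= e ^+ 2.
Proof.
move=> g0 p0 gd mg t01 X0 pX mX.
have [m0|m0] := ger0P m.
  apply: (secular_root_bound_pos g0 p0 gd _ t01 X0 pX mX).
  by rewrite m0 -(ger0_norm m0).
apply: (@secular_root_bound_pos p (fun j => - d j) g (- m) e t X) => //.
- by move=> j; rewrite normrN.
- by rewrite oppr_ge0 (ltW m0) -(ltr0_norm m0).
rewrite mulNr mX -mulrN -sumrN; congr (_ * _); apply: eq_bigr => j _.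
by rewrite -opprD invrN mulrN.
Qed.

(* With [1 / (m + d) = 1 / d - m / (d (m + d))], the root differs from the sum of
   [p / d] by at most [|m| e b / (g - |m|)], and [|m| <= e ^ 2 / g] bounds this by
   [e ^ 2 b / (2 (g - e))]. *)
Lemma secular_root_expansion p d g m e b N X :
  (forall j, 0 <= p j) -> (forall j, g <= `|d j|) -> `|m| < g ->
  0 <= e < g -> 0 <= b -> 0 < X ->
  \sum_j p j <= e ^+ 2 * X -> \sum_j p j / d j ^+ 2 <= b ^+ 2 * X ->
  `|\sum_j p j / d j| <= N * X ->
  m * X = \sum_j p j / (m + d j) -> `|m| * g <= e ^+ 2 ->
  `|m| <= N + 2%:R / 3%:R * (e ^+ 2 * b / (g - e)).
Proof.
move=> p0 gd mg /andP[e0 eg] b0 X0 pX pdX NX mX mge.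
have g0 : 0 < g by apply: le_lt_trans eg.
have d_neq0 j : d j != 0 by rewrite -normr_gt0 (lt_le_trans g0).
have md_ge j : g - `|m| <= `|m + d j|.
  have := lerB_normD (d j) m; rewrite [d j + m]addrC => h.
  by apply: le_trans h; rewrite lerB.
have md_neq0 j : m + d j != 0.
  by rewrite -normr_gt0; apply: lt_le_trans (md_ge j); rewrite subr_gt0.
(* Cauchy-Schwarz with weights [p j] and values [1 / |d j|]. *)
have sum_ebX : \sum_j p j * `|d j|^-1 <= e * b * X.
  have Z0 : 0 <= \sum_j p j * `|d j|^-1.
    by apply: sumr_ge0 => j _; rewrite mulr_ge0 ?invr_ge0.
  rewrite -(@ler_pXn2r _ 2) ?nnegrE ?mulr_ge0 // ?(ltW X0) //.
  apply: le_trans (weighted_cauchy_schwarz _ p0) _.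
  have -> : (e * b * X) ^+ 2 = e ^+ 2 * X * (b ^+ 2 * X) by ring.
  rewrite ler_pM ?sumr_ge0 // => [j _|]; first by rewrite mulr_ge0 ?sqr_ge0.
  apply: le_trans pdX; apply: ler_sum => j _.
  by rewrite exprVn -normrX ger0_norm ?sqr_ge0.
have remainder : `|\sum_j p j / (d j * (m + d j))| <= (g - `|m|)^-1 * (e * b * X).
  apply: le_trans (ler_norm_sum _ _ _) _.
  apply: (@le_trans _ _ ((g - `|m|)^-1 * \sum_j p j * `|d j|^-1)); last first.
    by rewrite ler_wpM2l // invr_ge0 subr_ge0 ltW.
  rewrite mulr_sumr; apply: ler_sum => j _.
  rewrite normrM ger0_norm // normfV normrM invfM mulrA mulrC ler_wpM2r //.
    by rewrite mulr_ge0 ?invr_ge0.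
  by rewrite lef_pV2 ?posrE ?subr_gt0 ?normr_gt0.
have expansion : m * X = \sum_j p j / d j - m * \sum_j p j / (d j * (m + d j)).
  rewrite mX mulr_sumr -sumrB; apply: eq_bigr => j _.
  by field; rewrite d_neq0 md_neq0.
have le_mX : `|m| * X <= (N + `|m| * ((g - `|m|)^-1 * (e * b))) * X.
  rewrite -{1}(gtr0_norm X0) -normrM expansion mulrDl.
  apply: le_trans (ler_normB _ _) _; rewrite lerD //.
  by rewrite normrM -[leRHS]mulrA ler_wpM2l // -mulrA.
move: le_mX; rewrite ler_pM2r // => le_m; apply: le_trans le_m _; rewrite lerD2l.
have -> : `|m| * ((g - `|m|)^-1 * (e * b)) = (`|m| / (g - `|m|)) * (e * b) by ring.
have -> : 2 / 3 * (e ^+ 2 * b / (g - e)) = (2 / 3 * (e / (g - e))) * (e * b) by ring.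
rewrite ler_wpM2r ?mulr_ge0 //.
have gm0 : 0 < g - `|m| by rewrite subr_gt0.
have ge0 : 0 < g - e by rewrite subr_gt0.
rewrite ler_pdivrMr //.
have -> : 2 / 3 * (e / (g - e)) * (g - `|m|) = 2 / 3 * e * (g - `|m|) / (g - e) by ring.
rewrite ler_pdivlMr // -(ler_pM2r g0); move: mge (normr_ge0 m) => mge m_ge0.
(* Collecting [|m|], the goal is [|m| g (g - e/3) <= (2/3) e g^2]. [h1] replaces [|m| g] by [e^2];
   what remains is one third of [h2]. *)
have h1 : 0 <= (e ^+ 2 - `|m| * g) * (g - e / 3) by rewrite mulr_ge0 //; lra.
have h2 : 0 <= e * ((g - e) * (2 * g - e)) by rewrite !mulr_ge0 //; lra.
by lra.
Qed.

End SecularBounds.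

(** * Block elimination and the Sylvester equation *)

Section BlockPerturbation.
Context {R : realType} {n1 n2 : nat}.
Local Notation C := R[i].
Context (P : 'M[C]_n2) (d : 'I_n2 -> R) (l : R).
Context (uP : P \is unitarymx).
Let D2 := P^t* *m diag_mx (\row_j (d j)%:C) *m P.

(** Meant for the coordinates [z] of [x B1 P*] and [w] of [x E1 P*], with [s = l - d j]: it turns
    expressions in [B1] into weighted sums of [cabs w ^+ 2]. *)
Lemma cabs_sqr_div (z w : C) (s : R) : s != 0 -> z * s%:C = w ->
  z * Num.conj w = (cabs w ^+ 2 / s)%:C /\ cabs z ^+ 2 = cabs w ^+ 2 / s ^+ 2.
Proof.
move=> s0 <-; have sC : s%:C != 0 :> C by rewrite (inj_eq (@complexI R) s 0).
have -> : cabs (z * s%:C) ^+ 2 = cabs z ^+ 2 * s ^+ 2.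
  rewrite [cabs _]ComplexField.Normc.normcM exprMn -!/(cabs _) [cabs s%:C]cabs_real.
  by rewrite real_normK // num_real.
split; last by field.
have -> : Num.conj (z * s%:C) = Num.conj z * s%:C.
  by rewrite rmorphM; congr (_ * _); exact: conjc_real.
by rewrite [s ^+ 2]expr2 mulrA mulfK // rmorphM /= [X in _ = X * _]cabs_sqrE mulrA.
Qed.

(** In the eigenbasis of [D2] the second block equation is [z_j (m + l - d_j) = t w_j]. Pairing the
    first, [m x = t y E1*], with [x] and substituting eliminates [y]. *)
Lemma secular_equation (E1 : 'M[C]_(n1, n2)) (v : 'rV[C]_(n1 + n2)) (t m : R) :
  v != 0 -> (forall j, m + (l - d j) != 0) ->
  v *m block_mx l%:C%:M (t%:C *: E1) (t%:C *: E1^t*) D2 = (l + m)%:C *: v ->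
  exists2 x : 'rV[C]_n1, x != 0 &
    m * sqnorm x =
    t ^+ 2 * \sum_j cabs ((x *m E1 *m P^t*) 0 j) ^+ 2 / (m + (l - d j)).
Proof.
rewrite -[v]hsubmxK; move: (lsubmx v) (rsubmx v) => x y v0 md0.
rewrite mul_row_block scale_row_mx => /eq_row_mx[eqx eqy].
set z := y *m P^t*; set w := x *m E1 *m P^t*.
have zE j : z 0 j * (m + (l - d j))%:C = t%:C * w 0 j.
  have /(congr1 (fun M => (M *m P^t*) 0 j)) := eqy.
  rewrite mulmxDl /D2 !mulmxA mulmxtVK // -/z -!scalemxAr -!scalemxAl -/w -/z.
  clearbody w z; rewrite mul_mx_diag !mxE => h.
  rewrite -[RHS](addrK (z 0 j * (d j)%:C)) h !rmorphD rmorphN /=; ring.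
exists x.
  (* If [x = 0], then [w = 0], and the nonzero factors [m + (l - d j)] force [z = 0], so [y]
     vanishes too. *)
  apply: contraNneq v0 => x0; have w0 : w = 0 by rewrite /w x0 !mul0mx.
  have z0 : z = 0.
    apply/rowP => j; have /eqP := zE j; rewrite w0 !mxE mulr0 mulf_eq0.
    by rewrite (inj_eq (@complexI R) _ 0) (negbTE (md0 j)) orbF => /eqP.
  have <- : z *m P = y by rewrite /z mulmxKtV.
  by rewrite z0 x0 mul0mx row_mx0.
apply: complexI; rewrite rmorphM /= sqnormE.
have -> : m%:C * (x *m x^t*) 0 0 = ((m%:C *: x) *m x^t*) 0 0 by rewrite -scalemxAl [RHS]mxE.
have -> : m%:C *: x = t%:C *: (y *m E1^t*).
  move: eqx; rewrite mul_mx_scalar -scalemxAr rmorphD /= scalerDl.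
  by move=> /addrI.
rewrite -scalemxAl mxE -mulmxA.
have -> : E1^t* *m x^t* = (x *m E1)^t* by rewrite trmx_mul map_mxM.
have -> : y *m (x *m E1)^t* = z *m w^t*.
  by rewrite /z /w [(_ *m P^t*)^T]trmx_mul map_mxM trmxCK mulmxA mulmxKtV.
rewrite rmorphM rmorph_sum /= [X in _ = X * _]rmorphXn /= expr2 -mulrA; congr (_ * _).
rewrite mxE mulr_sumr; apply: eq_bigr => j _.
have zw : z 0 j = t%:C * w 0 j / (m + (l - d j))%:C.
  by rewrite -zE mulfK // (inj_eq (@complexI R) _ 0).
rewrite rmorphM /= [X in _ = _ * (X * _)]cabs_sqrE zw !mxE fmorphV.
by rewrite -!mulrA; congr (_ * (_ * _)); rewrite mulrC.
Qed.

(** In the eigenbasis of [D2] the Sylvester equation decouples into scalar equations. *)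
Lemma sylvester_diag (E1 B1 : 'M[C]_(n1, n2)) (x : 'rV[C]_n1) (j : 'I_n2) :
  E1 = l%:C%:M *m B1 - B1 *m D2 ->
  (x *m B1 *m P^t*) 0 j * (l - d j)%:C = (x *m E1 *m P^t*) 0 j.
Proof.
move=> ->; rewrite mul_scalar_mx mulmxBr mulmxBl -!scalemxAr -!scalemxAl /D2.
rewrite !mulmxA mulmxtVK // mul_mx_diag !mxE rmorphB /=.
by rewrite mulrBr; congr (_ - _); rewrite mulrC.
Qed.

End BlockPerturbation.

(** * Quadratic form of the off-diagonal perturbation *)

Section OffDiagonal.
Context {R : realType} {n1 n2 : nat}.
Local Notation C := R[i].

(** The form is [x E1 y*] plus its conjugate, at most [2 e |x| |y| <= e (|x|^2 + |y|^2)]. Weyl's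
    inequality thus needs only the norm of [E1]. *)
Lemma off_diagonal_form (E1 : 'M[C]_(n1, n2)) (u : 'rV[C]_(n1 + n2)) :
  cabs ((u *m block_mx 0 E1 (E1^t*) 0 *m u^t*) 0 0) <= spectral_norm E1 * sqnorm u.
Proof.
rewrite -[u]hsubmxK; move: (lsubmx u) (rsubmx u) => x y.
set e := spectral_norm E1; have e0 : 0 <= e by exact: spectral_norm_ge0.
rewrite mul_row_block !mulmx0 add0r addr0 tr_row_mx map_col_mx mul_row_col mxE.
have -> : (y *m E1^t* *m x^t*) 0 0 = Num.conj ((x *m E1 *m y^t*) 0 0).
  transitivity (((x *m E1 *m y^t*)^t*) 0 0); last by rewrite !mxE.
  by rewrite !trmx_mul !map_mxM trmxCK mulmxA.
have -> : sqnorm (row_mx x y) = sqnorm x + sqnorm y.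
  rewrite /sqnorm big_split_ord /=; congr (_ + _); apply: eq_bigr => j _.
    by rewrite row_mxEl.
  by rewrite row_mxEr.
set c := (x *m E1 *m y^t*) 0 0.
have hc : cabs c ^+ 2 <= e ^+ 2 * (sqnorm x * sqnorm y).
  apply: le_trans (cauchy_schwarz _ _) _.
  by rewrite mulrA ler_wpM2r ?sqnorm_ge0 ?sqnorm_mulmx.
apply: (@le_trans _ _ (2 * cabs c)).
  by rewrite -lecR -cabsE (le_trans (ler_normD _ _)) // norm_conjC cabsE mulr2n mulrDl mul1r rmorphD.
rewrite -(@ler_pXn2r _ 2) ?nnegrE ?mulr_ge0 ?addr_ge0 ?cabs_ge0 ?sqnorm_ge0 //.
move: hc; have := sqr_ge0 (e * (sqnorm x - sqnorm y)).
set X := sqnorm x; set Y := sqnorm y; rewrite !exprMn => h1 h2.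
have -> : (X + Y) ^+ 2 = (X - Y) ^+ 2 + 4 * (X * Y) by ring.
by lra.
Qed.

End OffDiagonal.

(** * Hermitian matrices and localization of an eigenvalue branch *)

Lemma hermsymmxP (C : numClosedFieldType) (n : nat) (A : 'M[C]_n) :
  reflect (A^t* = A) (A \is hermsymmx).
Proof.
rewrite is_hermitianmxE expr0 scale1r eq_sym; exact: eqP.
Qed.

Lemma hermsymmxD (C : numClosedFieldType) (n : nat) (A A' : 'M[C]_n) :
  A \is hermsymmx -> A' \is hermsymmx -> A + A' \is hermsymmx.
Proof.
by move=> /hermsymmxP hA /hermsymmxP hA'; apply/hermsymmxP; rewrite linearD map_mxD hA hA'.
Qed.

Lemma hermsymmxB (C : numClosedFieldType) (n : nat) (A A' : 'M[C]_n) :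
  A \is hermsymmx -> A' \is hermsymmx -> A - A' \is hermsymmx.
Proof.
by move=> /hermsymmxP hA /hermsymmxP hA'; apply/hermsymmxP; rewrite linearB map_mxB hA hA'.
Qed.

(* A continuous branch cannot cross a forbidden annulus, and sorted branches move
   by at most [e] by Weyl's inequality. *)
Lemma eigenvalue_family_near (R : realType) (n : nat) (A : R -> 'M[R[i]]_n)
    (lam : 'I_n -> R -> R) (i : 'I_n) (e g : R) :
  A 0 \is hermsymmx -> A 1 \is hermsymmx ->
  (forall u : 'rV[R[i]]_n, cabs ((u *m (A 1 - A 0) *m u^t*) 0 0) <= e * sqnorm u) ->
  0 <= e < g -> eigenvalue_family A lam ->
  (forall t, 0 <= t <= 1 -> `|lam i t - lam i 0| < g ->
     `|lam i t - lam i 0| * g <= e ^+ 2) ->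
  `|lam i 1 - lam i 0| < g.
Proof.
move=> hA0 hA1 formA /andP[e0 eg] [charA [cont|sorted]] excl; last first.
  apply: le_lt_trans eg.
  have le01 : 0 <= (0 : R) <= 1 by rewrite lexx ler01.
  have le11 : 0 <= (1 : R) <= 1 by rewrite lexx ler01.
  have hD : A 1 - A 0 \is hermsymmx by exact: hermsymmxB.
  (* A Hermitian form is real, so the modulus bound is two-sided, one side for each direction of
     Weyl's inequality. *)
  have form_real u : exists2 r : R, (u *m (A 1 - A 0) *m u^t*) 0 0 = r%:C &
      `|r| <= e * sqnorm u.
    have [P [d [_ eD]]] := hermitian_diagonalization hD.
    have := formA u; rewrite eD diag_quadratic_form cabs_real => h.
    by eexists; first by reflexivity.
  have formB u : (u *m A 1 *m u^t*) 0 0 =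
      (u *m A 0 *m u^t*) 0 0 + (u *m (A 1 - A 0) *m u^t*) 0 0.
    by rewrite -{1}(subrK (A 0) (A 1)) mulmxDr mulmxDl [LHS]mxE addrC.
  rewrite ler_distl; apply/andP; split.
    rewrite lerBlDr.
    apply: (weyl_le i hA1 hA0 (charA 1 le11) (charA 0 le01)).
    - exact: sorted le11.
    - exact: sorted le01.
    move=> u; rewrite formB; have [r -> rb] := form_real u.
    rewrite -addrA lerDl -rmorphD ler0c; move: rb; rewrite ler_norml => /andP[rb _].
    by lra.
  apply: (weyl_le i hA0 hA1 (charA 0 le01) (charA 1 le11)).
  - exact: sorted le01.
  - exact: sorted le11.
  move=> u; rewrite formB; have [r -> rb] := form_real u.
  by rewrite lerD2l lecR; apply: le_trans rb; exact: ler_norm.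
have g0 : 0 < g by apply: le_lt_trans eg.
rewrite ltNge; apply/negP => far.
pose f t := `|lam i t - lam i 0|.
have f0 : f 0 = 0 by rewrite /f subrr normr0.
have ef : e ^+ 2 / g < g by rewrite ltr_pdivrMr // expr2 ltr_pM.
(* The midpoint of the forbidden interval: [f], starting at 0 and ending at or above [g], would have
   to take this value, against [excl]. *)
pose v := (e ^+ 2 / g + g) / 2.
have v0 : 0 <= e ^+ 2 / g by rewrite divr_ge0 ?sqr_ge0 // ltW.
have cf : {within `[0%R, 1%R], continuous f}.
  move=> x; apply: cvg_norm; apply: cvgB; [exact: cont | exact: cvg_cst].
have [|t] := IVT ler01 cf (v := v).
  rewrite f0 min_l ?normr_ge0 // max_r ?normr_ge0 // /v -/(f 1).
  by apply/andP; split; move: far; rewrite -/(f 1); lra.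
rewrite in_itv /= => t01 ft.
have := excl t t01; rewrite -/(f t) ft -ler_pdivlMr // /v => h.
by have := h _; lra.
Qed.

Lemma hermitian_block_dr (R : realType) (n1 n2 : nat) (D1 : 'M[R[i]]_n1)
    (D2 : 'M[R[i]]_n2) :
  block_mx D1 0 0 D2 \is hermsymmx -> D2 \is hermsymmx.
Proof.
move=> /hermsymmxP; rewrite tr_block_mx map_block_mx => /eq_block_mx[_ _ _ h].
exact/hermsymmxP.
Qed.

(** Row [j] of [P] is an eigenvector, nonzero because [P P* = 1]. *)
Lemma eigenvalue_unitary_diag (C : numClosedFieldType) (n : nat) (P : 'M[C]_n)
    (d : 'rV[C]_n) (j : 'I_n) :
  P \is unitarymx -> eigenvalue (P^t* *m diag_mx d *m P) (d 0 j).
Proof.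
move=> uP; apply/eigenvalueP; exists (row j P).
  rewrite rowE !mulmxA -[_ *m P *m _]mulmxA (unitarymxP uP) mulmx1.
  by rewrite -[_ *m diag_mx d]rowE row_diag_mx -scalemxAl.
apply/eqP => r0; have := congr1 (row j) (unitarymxP uP).
rewrite row_mul r0 mul0mx => /rowP/(_ j); rewrite !mxE eqxx => /eqP.
by rewrite eq_sym oner_eq0.
Qed.

(** * The eigenvalue bound, from the secular equation at [t = 1] *)

Theorem theorem6p2 (R : realType) (n1 n2 : nat)
    (D E B : 'M[R[i]]_(n1 + n2))
    (D1 : 'M[R[i]]_n1) (D2 : 'M[R[i]]_n2) (E1 B1 : 'M[R[i]]_(n1, n2))
    (lambda1 : R[i]) (gap : R) (lam : 'I_(n1 + n2) -> R -> R)
    (i : 'I_(n1 + n2)) :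
  D \is hermsymmx ->
  D = block_mx D1 0 0 D2 ->
  D1 = lambda1%:M ->
  is_min [set cabs (lambda1 - z) | z in [set z : R[i] | eigenvalue D2 z]] gap ->
  0 < gap ->
  E \is hermsymmx ->
  E = block_mx 0 E1 (E1 ^t*) 0 ->
  B = block_mx 0 B1 (- (B1 ^t*)) 0 ->
  E1 = D1 *m B1 - B1 *m D2 ->
  spectral_norm E1 < gap ->
  eigenvalue_family (fun t : R => D + t%:C *: E) lam ->
  eigenvalue D1 ((lam i 0)%:C) ->
  `|lam i 1 - lam i 0| <=
    2%:R^-1 * spectral_norm (B1 *m (E1 ^t*) + E1 *m (B1 ^t*)) +
    2%:R / 3%:R *
      (spectral_norm E1 ^+ 2 * spectral_norm B1 / (gap - spectral_norm E1)).
Proof.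
move=> hD eD eD1 [_ gap_le] gap0 hE eE _ sylv eg fam eig.
(* A scalar matrix has only its scalar as eigenvalue; in particular [lambda1] is real. *)
have el : (lam i 0)%:C = lambda1.
  have [v vD v0] := eigenvalueP eig; move: vD; rewrite eD1 mul_mx_scalar => /eqP.
  by rewrite -subr_eq0 -scalerBl scaler_eq0 (negbTE v0) orbF subr_eq0 => /eqP.
move: fam eig gap_le; set l := lam i 0 in el *.
rewrite -{}el in eD1 *; rewrite {}eD1 in eD sylv; move=> fam _ gap_le.
set e := spectral_norm E1; set b := spectral_norm B1.
have e0 : 0 <= e by exact: spectral_norm_ge0.
have b0 : 0 <= b by exact: spectral_norm_ge0.
have [P [d [uP eD2]]] : exists (P : 'M[R[i]]_n2) (d : 'I_n2 -> R), P \is unitarymx /\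
    D2 = P^t* *m diag_mx (\row_j (d j)%:C) *m P.
  by apply: hermitian_diagonalization; apply: (@hermitian_block_dr _ n1 _ l%:C%:M); rewrite -eD.
have gap_d j : gap <= `|l - d j|.
  apply: gap_le; exists (d j)%:C; last by rewrite -rmorphB cabs_real.
  have := eigenvalue_unitary_diag (\row_j (d j)%:C) j uP.
  by rewrite /= eD2 mxE.
have secular t : 0 <= t <= 1 -> `|lam i t - l| < gap ->
    exists2 x : 'rV[R[i]]_n1, x != 0 & (lam i t - l) * sqnorm x =
      t ^+ 2 * \sum_j cabs ((x *m E1 *m P^t*) 0 j) ^+ 2 / ((lam i t - l) + (l - d j)).
  move=> t01 near.
  have : eigenvalue (D + t%:C *: E) (lam i t)%:C.
    rewrite eigenvalue_root_char (fam.1 t t01) /root horner_prod.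
    by apply/eqP; rewrite (bigD1 i) //= hornerXsubC subrr mul0r.
  case/eigenvalueP => v + v0.
  rewrite eD eE scale_block_mx add_block_mx !scaler0 !addr0 !add0r eD2 => vE.
  apply: (secular_equation uP v0) => [j|].
    (* No denominator vanishes, since [|lam i t - l| < gap <= |l - d j|]. *)
    rewrite -normr_gt0 addrC; have := gap_d j; have := lerB_normD (l - d j) (lam i t - l).
    by lra.
  by rewrite vE addrC subrK.
have sum_p (x : 'rV[R[i]]_n1) : \sum_j cabs ((x *m E1 *m P^t*) 0 j) ^+ 2 <= e ^+ 2 * sqnorm x.
  by rewrite -[leLHS]/(sqnorm _) sqnorm_unitary // sqnorm_mulmx.
have excl t : 0 <= t <= 1 -> `|lam i t - l| < gap ->
    `|lam i t - l| * gap <= e ^+ 2.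
  move=> t01 near; have [x x0 eqx] := secular t t01 near.
  by apply: (secular_root_bound gap0 _ gap_d near t01 _ (sum_p x) eqx);
    rewrite ?sqnorm_gt0 // => j; exact: sqr_ge0.
(* The excluded annulus and the form bound on [E] keep the branch close to [l], which makes the
   secular equation available at [t = 1]. *)
have near : `|lam i 1 - l| < gap.
  apply: (eigenvalue_family_near (e := e) _ _ _ _ fam excl); rewrite ?scale0r ?addr0 //.
  - by rewrite scale1r; exact: hermsymmxD.
  - by move=> u; rewrite scale1r addrC addKr eE off_diagonal_form.
  by rewrite e0.
have le11 : 0 <= (1 : R) <= 1 by rewrite ler01 lexx.
have [x x0 eqx] := secular 1 le11 near.
rewrite expr1n mul1r in eqx.
set N := spectral_norm _.
have d_neq0 j : l - d j != 0 by rewrite -normr_gt0 (lt_le_trans gap0).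
rewrite eD2 in sylv.
have sylv_j j := cabs_sqr_div (d_neq0 j) (sylvester_diag uP x j sylv).
have formBE : (x *m (B1 *m E1^t*) *m x^t*) 0 0 =
    (\sum_j cabs ((x *m E1 *m P^t*) 0 j) ^+ 2 / (l - d j))%:C.
  have -> : x *m (B1 *m E1^t*) *m x^t* = (x *m B1 *m P^t*) *m (x *m E1 *m P^t*)^t*.
    by rewrite [(x *m E1 *m _)^T]trmx_mul map_mxM trmxCK [(x *m E1)^T]trmx_mul map_mxM
      !mulmxA mulmxKtV.
  rewrite rmorph_sum mxE; apply: eq_bigr => j _.
  by rewrite -[RHS](sylv_j j).1 [X in _ * X]mxE [X in Num.conj X]mxE.
(* This form is the conjugate of the preceding one, whose value is real. *)
have formEB : (x *m (E1 *m B1^t*) *m x^t*) 0 0 =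
    (\sum_j cabs ((x *m E1 *m P^t*) 0 j) ^+ 2 / (l - d j))%:C.
  transitivity (Num.conj ((x *m (B1 *m E1^t*) *m x^t*) 0 0)).
    transitivity (((x *m (B1 *m E1^t*) *m x^t*)^t*) 0 0); last by rewrite !mxE.
    by rewrite !trmx_mul !map_mxM !trmxCK !mulmxA.
  by rewrite formBE; exact: conjc_real.
apply: (secular_root_expansion _ gap_d near _ b0 _ (sum_p x) _ _ eqx (excl 1 le11 near)).
- by move=> j; exact: sqr_ge0.
- by rewrite e0.
- by rewrite sqnorm_gt0.
(* By the Sylvester equation this sum is the squared norm of [x B1]. *)
- rewrite (eq_bigr (fun j => cabs ((x *m B1 *m P^t*) 0 j) ^+ 2)).
    by rewrite -[leLHS]/(sqnorm _) sqnorm_unitary // sqnorm_mulmx.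
  by move=> j _; rewrite (sylv_j j).2.
(* The symmetrized form is twice the sum of [p_j / (l - d_j)], whence the factor one half. *)
have := spectral_norm_form (B1 *m E1^t* + E1 *m B1^t*) x.
rewrite -/N mulmxDr mulmxDl mxE formBE formEB -rmorphD cabs_real -mulr2n.
by rewrite normrMn -mulr_natr; lra.
Qed.
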